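(* Let $\mathcal{H}$ be a finite-dimensional complex Hilbert space, let $\rho,\sigma$ be positive semidefinite operators on $\mathcal{H}$ with $\operatorname{supp}(\rho)\subseteq\operatorname{supp}(\sigma)$, and let $t\in(0,1]$. For $Z\in\mathfrak{L}(\mathcal{H})$ define $$g(Z,Z^\dagger)=\operatorname{Tr}[\rho]+\operatorname{Tr}[\rho(Z+Z^\dagger)]+(1-t)\operatorname{Tr}[\rho Z^\dagger Z]+t\operatorname{Tr}[\sigma ZZ^\dagger].$$ Then $g$ is operator-convex with respect to $Z$. Moreover, any solution $\tilde Z\in\mathfrak{L}(\mathcal{H})$ of the Sylvester equation $$(1-t)\rho\tilde Z^\dagger+t\tilde Z^\dagger\sigma=-\rho,\qquad\text{equivalently}\qquad(1-t)\tilde Z\rho+t\sigma\tilde Z=-\rho,$$ is an optimizer of the problem $\inf_{Z\in\mathfrak{L}(\mathcal{H})}g(Z,Z^\dagger)$. This equation always admits at least one solution, and the solution is unique if and only if at least one of $\rho$ and $\sigma$ is full-rank.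
   Context: $\mathfrak{L}(\mathcal{H})$ is the set of all (bounded) linear operators on $\mathcal{H}$. The support $\operatorname{supp}(\rho)$ of a positive semidefinite operator $\rho$ is the orthogonal complement of its kernel. A function $g:\mathfrak{L}(\mathcal{H})\to\mathbb{R}$ is called operator-convex here if $g((1-\omega)X+\omega Y)\le(1-\omega)g(X)+\omega g(Y)$ for all $X,Y\in\mathfrak{L}(\mathcal{H})$ and $\omega\in[0,1]$. The function $Z\mapsto g(Z,Z^\dagger)$ is real-valued; the notation $g(Z,Z^\dagger)$ only indicates that $Z^\dagger$ (the adjoint of $Z$) appears in the formula. An optimizer is an operator at which the infimum is attained. *)

(* Defs.v *)
(* The Hilbert space is R[i]^n with its standard inner product; operators are
   n x n matrices acting on column vectors, so that *m is the composition. *)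
From HB Require Import structures.
From mathcomp Require Export all_boot all_order all_algebra.
From mathcomp Require Export complex.
From mathcomp Require Export all_classical all_reals ereal.

Set Implicit Arguments.
Unset Strict Implicit.
Unset Printing Implicit Defensive.

Import Order.TTheory GRing.Theory Num.Theory.
Local Open Scope classical_set_scope.
Local Open Scope complex_scope.
Local Open Scope sesquilinear_scope.
Local Open Scope ring_scope.

(* Conjugate-linear in the first argument. *)
Definition inner (R : realType) (n : nat) (u v : 'cV[R[i]]_n) : R[i] :=
  (u^t* *m v) 0 0.

(* The order of R[i] is partial: 0 <= z says that z is real and nonnegative. *)
Definition psdmx (R : realType) (n : nat) (A : 'M[R[i]]_n) : Prop :=
  A^t* = A /\ forall u : 'cV[R[i]]_n, 0 <= inner u (A *m u).

Definition supp (R : realType) (n : nat) (A : 'M[R[i]]_n) : set 'cV[R[i]]_n :=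
  [set v | forall u : 'cV[R[i]]_n, A *m u = 0 -> inner u v = 0].

Definition operator_convex (R : realType) (n : nat) (f : 'M[R[i]]_n -> R) :
    Prop :=
  forall (X Y : 'M[R[i]]_n) (w : R), 0 <= w <= 1 ->
    f ((1 - w)%:C *: X + w%:C *: Y) <= (1 - w) * f X + w * f Y.

(* The infimum is taken in the extended reals, where it always exists: the real
   infimum of the library is 0 by convention on sets that are not bounded
   below. *)
Definition is_optimizer (R : realType) (n : nat) (f : 'M[R[i]]_n -> R)
    (Z : 'M[R[i]]_n) : Prop :=
  (f Z)%:E = ereal_inf [set (f W)%:E | W in [set: 'M[R[i]]_n]].

Definition gC (R : realType) (n : nat) (rho sigma : 'M[R[i]]_n) (t : R)
    (Z : 'M[R[i]]_n) : R[i] :=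
  \tr rho + \tr (rho *m (Z + Z^t*))
  + (1 - t)%:C * \tr (rho *m Z^t* *m Z)
  + t%:C * \tr (sigma *m Z *m Z^t*).

(* gC takes real values when rho and sigma are positive semidefinite; g is gC
   as a function with values in R. *)
Definition g (R : realType) (n : nat) (rho sigma : 'M[R[i]]_n) (t : R)
    (Z : 'M[R[i]]_n) : R :=
  complex.Re (gC rho sigma t Z).

Definition sylvester_adj (R : realType) (n : nat) (rho sigma : 'M[R[i]]_n)
    (t : R) (Z : 'M[R[i]]_n) : Prop :=
  (1 - t)%:C *: (rho *m Z^t*) + t%:C *: (Z^t* *m sigma) = - rho.

Definition sylvester (R : realType) (n : nat) (rho sigma : 'M[R[i]]_n)
    (t : R) (Z : 'M[R[i]]_n) : Prop :=
  (1 - t)%:C *: (Z *m rho) + t%:C *: (sigma *m Z) = - rho.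

(* Main.v *)
(* In unitary bases diagonalizing [sigma] and [rho], with eigenvalues [s i] and
   [r j], the Sylvester equation reads entrywise
   [((1 - t) r_j + t s_i) Y_ij = - B_ij], where [B] represents [rho]. A
   coefficient vanishes only if [s_i = 0], and then the [i]-th row of [B] is [0]
   because the kernel of [sigma] is contained in that of [rho]; if [sigma] is
   singular, [w w^*] with [w] in its kernel solves the homogeneous equation.
   Moreover the quadratic part of [g] is nonnegative, which gives convexity, and
   the Sylvester equation says exactly that the linear part of
   [H |-> g (Z + H)] vanishes. *)
From mathcomp Require Import ring.
From mathcomp Require Import sesquilinear spectral.
Require Import Defs.

Set Implicit Arguments.
Unset Strict Implicit.
Unset Printing Implicit Defensive.

Import Order.TTheory GRing.Theory Num.Theory.
Local Open Scope classical_set_scope.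
Local Open Scope complex_scope.
Local Open Scope sesquilinear_scope.
Local Open Scope ring_scope.

(** * Adjoints, traces, and the expansion of the functional *)

Section Adjoint.
Variable C : numClosedFieldType.

Lemma adjmxM m n p (A : 'M[C]_(m, n)) (B : 'M[C]_(n, p)) :
  (A *m B)^t* = B^t* *m A^t*.
Proof. by rewrite trmx_mul map_mxM. Qed.

Lemma adjmxD m n (A B : 'M[C]_(m, n)) : (A + B)^t* = A^t* + B^t*.
Proof. by rewrite linearD map_mxD. Qed.

Lemma adjmxN m n (A : 'M[C]_(m, n)) : (- A)^t* = - A^t*.
Proof. by rewrite linearN map_mxN. Qed.

Lemma adjmxZ m n (a : C) (A : 'M[C]_(m, n)) : (a *: A)^t* = a^* *: A^t*.
Proof. by rewrite linearZ map_mxZ. Qed.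

Lemma adjmx_inj m n : injective (fun A : 'M[C]_(m, n) => A^t*).
Proof. by move=> A B /(congr1 (fun M => M^t*)); rewrite !trmxCK. Qed.

Lemma mxtrace_adj n (A : 'M[C]_n) : \tr (A^t*) = (\tr A)^*.
Proof. by rewrite -[in RHS]mxtrace_tr rmorph_sum; apply: eq_bigr => i _; rewrite !mxE. Qed.

Lemma mxtrace_mulDr n (A B D : 'M[C]_n) :
  \tr (A *m (B + D)) = \tr (A *m B) + \tr (A *m D).
Proof. by rewrite mulmxDr mxtraceD. Qed.

Lemma mxtrace_mulDD n (A B1 B2 D1 D2 : 'M[C]_n) :
  \tr (A *m (B1 + B2) *m (D1 + D2)) =
  \tr (A *m B1 *m D1) + \tr (A *m B1 *m D2)
  + (\tr (A *m B2 *m D1) + \tr (A *m B2 *m D2)).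
Proof. by rewrite [A *m _]mulmxDr mulmxDl mxtraceD !mxtrace_mulDr. Qed.

Lemma mxtrace_mulZr n (a : C) (A B : 'M[C]_n) : \tr (A *m (a *: B)) = a * \tr (A *m B).
Proof. by rewrite -scalemxAr mxtraceZ. Qed.

Lemma mxtrace_mulZm n (a : C) (A B D : 'M[C]_n) :
  \tr (A *m (a *: B) *m D) = a * \tr (A *m B *m D).
Proof. by rewrite -scalemxAr -scalemxAl mxtraceZ. Qed.

Lemma mxtrace_comb_mul n (a b : C) (A B D : 'M[C]_n) :
  \tr ((a *: A + b *: B) *m D) = a * \tr (A *m D) + b * \tr (B *m D).
Proof. by rewrite mulmxDl -!scalemxAl mxtraceD !mxtraceZ. Qed.

(** The increment is grouped by type: linear in [H], conjugate-linear in [H], then quadratic. The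
    Sylvester equation and its adjoint each cancel one of the first two groups. *)
Lemma quadratic_functional_add n (rho sigma Z H : 'M[C]_n) (a b : C) :
  \tr rho + \tr (rho *m ((Z + H) + (Z + H)^t*))
  + a * \tr (rho *m (Z + H)^t* *m (Z + H))
  + b * \tr (sigma *m (Z + H) *m (Z + H)^t*) =
  \tr rho + \tr (rho *m (Z + Z^t*))
  + a * \tr (rho *m Z^t* *m Z) + b * \tr (sigma *m Z *m Z^t*)
  + (\tr (rho *m H) + (a * \tr (rho *m Z^t* *m H) + b * \tr (sigma *m H *m Z^t*)))
  + (\tr (rho *m H^t*) + (a * \tr (rho *m H^t* *m Z) + b * \tr (sigma *m Z *m H^t*)))
  + (a * \tr (rho *m H^t* *m H) + b * \tr (sigma *m H *m H^t*)).
Proof.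
rewrite !adjmxD !mxtrace_mulDD !mxtrace_mulDr.
ring.
Qed.

(** For real [s] the linear and conjugate-linear groups scale alike, so the functional restricted to
    a real line is a quadratic polynomial. *)
Lemma quadratic_functional_line n (rho sigma Z H : 'M[C]_n) (a b s : C) :
  s^* = s ->
  \tr rho + \tr (rho *m ((Z + s *: H) + (Z + s *: H)^t*))
  + a * \tr (rho *m (Z + s *: H)^t* *m (Z + s *: H))
  + b * \tr (sigma *m (Z + s *: H) *m (Z + s *: H)^t*) =
  \tr rho + \tr (rho *m (Z + Z^t*))
  + a * \tr (rho *m Z^t* *m Z) + b * \tr (sigma *m Z *m Z^t*)
  + s * (\tr (rho *m H) + (a * \tr (rho *m Z^t* *m H) + b * \tr (sigma *m H *m Z^t*))
    + (\tr (rho *m H^t*) + (a * \tr (rho *m H^t* *m Z) + b * \tr (sigma *m Z *m H^t*))))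
  + s ^+ 2 * (a * \tr (rho *m H^t* *m H) + b * \tr (sigma *m H *m H^t*)).
Proof.
move=> sR; rewrite quadratic_functional_add adjmxZ sR.
rewrite !mxtrace_mulZm !mxtrace_mulZr.
ring.
Qed.
End Adjoint.

Lemma conjC_real (R : realType) (a : R) : (a%:C : R[i])^* = a%:C.
Proof. by apply: conj_Creal; apply/complex_realP; exists a. Qed.

(** * Positive semidefinite matrices: supports, kernels, diagonalization *)

Section Psd.
Variables (R : realType) (n : nat).
Implicit Types (A : 'M[R[i]]_n) (u v : 'cV[R[i]]_n).

Lemma innerM A u v : A^t* = A -> inner u (A *m v) = inner (A *m u) v.
Proof. by move=> Ah; rewrite /inner adjmxM Ah mulmxA. Qed.

Lemma inner_eq0 u : inner u u = 0 -> u = 0.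
Proof.
rewrite /inner mxE => /eqP.
rewrite psumr_eq0 => [/allP u0|i _]; last by rewrite !mxE mulrC mul_conjC_ge0.
apply/colP => i; rewrite mxE; apply/eqP.
by have := u0 i (mem_index_enum _); rewrite !mxE mulrC mul_conjC_eq0.
Qed.

(** The trace is the sum of the quadratic form of [A] over the columns of [Z]. *)
Lemma psdmx_tr_ge0 m A (Z : 'M[R[i]]_(n, m)) :
  psdmx A -> 0 <= \tr (Z^t* *m A *m Z).
Proof.
move=> [_ Apos]; apply: sumr_ge0 => i _.
have := Apos (col i Z); congr (_ <= _).
rewrite /inner mulmxA mxE [RHS]mxE; apply: eq_bigr => j _.
rewrite !mxE; congr (_ * _); apply: eq_bigr => k _; by rewrite !mxE.
Qed.

Lemma supp_hermitian_range A v : A^t* = A -> supp A (A *m v).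
Proof. by move=> Ah u Au; rewrite innerM // Au /inner trmx0 map_mx0 mul0mx mxE. Qed.

(* Range inclusion follows from that of the supports, and [A (A u)] lies in the
   range of [A]; being orthogonal to [u], it gives [|A u|^2 = 0]. *)
Lemma supp_le_ker A B u : A^t* = A -> supp A `<=` supp B ->
  B *m u = 0 -> A *m u = 0.
Proof.
move=> Ah sAB Bu; apply: inner_eq0.
by rewrite -innerM //; apply: (sAB _ (supp_hermitian_range _ Ah)).
Qed.

Lemma psdmx_spectral A : psdmx A -> exists (P : 'M[R[i]]_n) (d : 'rV[R[i]]_n),
  [/\ P *m P^t* = 1%:M, P^t* *m P = 1%:M, P *m A = diag_mx d *m P
    & forall i, 0 <= d 0 i].
Proof.
move=> [Ah Apos]; pose P := spectralmx A; pose d := spectral_diag A.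
have Pu : P \is unitarymx by exact: spectral_unitarymx.
have PPt : P *m P^t* = 1%:M by exact/unitarymxP.
have PtP : P^t* *m P = 1%:M by exact: mulmx1C.
have PA : P *m A = diag_mx d *m P.
  have /orthomx_spectralP : A \is normalmx by apply/normalmxP; rewrite Ah.
  rewrite invmx_unitary // -/P -/d => {1}->.
  by rewrite !mulmxA PPt mul1mx.
exists P, d; split=> // i.
(* This vector is a unit eigenvector of [A] for [d 0 i], so the quadratic form takes the value
   [d 0 i] on it. *)
have := Apos (P^t* *m delta_mx i 0); rewrite /inner adjmxM trmxCK.
have -> : A *m (P^t* *m delta_mx i 0) = P^t* *m (diag_mx d *m delta_mx i 0 : 'cV_n).
  rewrite -[A]mul1mx -PtP -(mulmxA _ P A) PA -!mulmxA (mulmxA P) PPt mul1mx //.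
rewrite -mulmxA (mulmxA P) PPt mul1mx mulmxA mul_mx_diag mxE (bigD1 i) //= big1.
  by rewrite !mxE !eqxx /= conjC1 mul1r mulr1 addr0.
by move=> j /negPf ji; rewrite !mxE ji mulr0.
Qed.
End Psd.

(** * The Sylvester equation: existence and uniqueness *)

Section Sylvester.
Variables (R : realType) (n : nat) (rho sigma : 'M[R[i]]_n) (t : R).
Hypotheses (rho_psd : psdmx rho) (sigma_psd : psdmx sigma).
Hypotheses (supp_le : supp rho `<=` supp sigma) (t_range : 0 < t <= 1).

Implicit Types Z W X Y H : 'M[R[i]]_n.

Let rhoH : rho^t* = rho. Proof. by case: rho_psd. Qed.
Let sigmaH : sigma^t* = sigma. Proof. by case: sigma_psd. Qed.

Lemma sylvester_adjE Z : sylvester_adj rho sigma t Z <-> sylvester rho sigma t Z.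
Proof.
rewrite /sylvester_adj /sylvester.
have -> : (1 - t)%:C *: (rho *m Z^t*) + t%:C *: (Z^t* *m sigma)
          = ((1 - t)%:C *: (Z *m rho) + t%:C *: (sigma *m Z))^t*.
  by rewrite adjmxD !adjmxZ !adjmxM !conjC_real rhoH sigmaH.
split=> [E|->]; last by rewrite adjmxN rhoH.
by apply: (@adjmx_inj _ n n); rewrite /= E adjmxN rhoH.
Qed.

(** Two bases are needed because [sigma] acts on [Z] from the left and [rho] from the right: [P]
    diagonalizes the former and [Q] the latter. *)
Lemma sylvester_spectral (P Q : 'M[R[i]]_n) (s r : 'rV[R[i]]_n) Z :
    P *m P^t* = 1%:M -> P *m sigma = diag_mx s *m P ->
    Q *m Q^t* = 1%:M -> Q *m rho = diag_mx r *m Q ->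
  sylvester rho sigma t Z <->
  forall i j, ((1 - t)%:C * r 0 j + t%:C * s 0 i) * (P *m Z *m Q^t*) i j
              = - (P *m rho *m Q^t*) i j.
Proof.
move=> PP Ps QQ Qr; have PtP := mulmx1C PP; have QtQ := mulmx1C QQ.
have rQ : rho *m Q^t* = Q^t* *m diag_mx r.
  by rewrite -[rho]mul1mx -QtQ -(mulmxA _ Q) Qr -!mulmxA QQ mulmx1.
have conj_inj (A B : 'M[R[i]]_n) : P *m A *m Q^t* = P *m B *m Q^t* -> A = B.
  move=> /(congr1 (fun M => P^t* *m M *m Q)).
  by rewrite !mulmxA PtP !mul1mx -!mulmxA QtQ !mulmx1.
have E i j : ((1 - t)%:C * r 0 j + t%:C * s 0 i) * (P *m Z *m Q^t*) i j =
    (P *m ((1 - t)%:C *: (Z *m rho) + t%:C *: (sigma *m Z)) *m Q^t*) i j.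
  rewrite mulmxDr mulmxDl -!scalemxAr -!scalemxAl !mulmxA Ps -!mulmxA rQ.
  rewrite !mulmxA -(mulmxA (diag_mx s)) -(mulmxA (diag_mx s)).
  by rewrite mul_mx_diag mul_diag_mx !mxE; ring.
split=> [ZE i j|ZE]; first by rewrite E ZE mulmxN mulNmx !mxE.
by apply: conj_inj; apply/matrixP => i j; rewrite -E ZE mulmxN mulNmx [RHS]mxE.
Qed.

(** Both summands are nonnegative, so both vanish. Only [b] is sure to be zero, since [t = 1] is
    allowed. *)
Lemma sylvester_denom_eq0 (a b : R[i]) : 0 <= a -> 0 <= b ->
  (1 - t)%:C * a + t%:C * b = 0 -> b = 0.
Proof.
case/andP: t_range => t0 t1 a0 b0 /eqP.
have t0' : (0 : R[i]) < t%:C by rewrite ltcR.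
have t1' : (0 : R[i]) <= (1 - t)%:C by rewrite ler0c subr_ge0.
rewrite paddr_eq0 ?mulr_ge0 // ?ltW // => /andP[_].
by rewrite mulf_eq0 gt_eqF //= => /eqP.
Qed.

Lemma spectral_row_ker (P : 'M[R[i]]_n) (s : 'rV[R[i]]_n) i :
    P *m sigma = diag_mx s *m P -> s 0 i = 0 ->
  row i P *m sigma = 0.
Proof.
by move=> Ps si; rewrite -row_mul Ps row_mul row_diag_mx si scale0r mul0mx.
Qed.

Lemma sylvester_solvable : exists Z, sylvester rho sigma t Z.
Proof.
have [P [s [PP PtP Ps s0]]] := psdmx_spectral sigma_psd.
have [Q [r [QQ QtQ Qr r0]]] := psdmx_spectral rho_psd.
(* When the denominator vanishes the quotient is [0], and so is the numerator. *)
pose Y := \matrix_(i, j) (- (P *m rho *m Q^t*) i j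
                          / ((1 - t)%:C * r 0 j + t%:C * s 0 i)).
exists (P^t* *m Y *m Q); apply/(sylvester_spectral _ PP Ps QQ Qr) => i j.
rewrite !mulmxA PP mul1mx -mulmxA QQ mulmx1 mxE.
have [d0|d0] := eqVneq ((1 - t)%:C * r 0 j + t%:C * s 0 i) 0; last first.
  by rewrite mulrC divfK.
have si := sylvester_denom_eq0 (r0 j) (s0 i) d0.
(* [supp_le_ker] speaks of columns, so the row of [P] is turned into a column by taking adjoints,
   and back afterwards. *)
have /(congr1 (fun M => M^t*)) := spectral_row_ker Ps si.
rewrite adjmxM sigmaH trmx0 map_mx0 => /(supp_le_ker rhoH supp_le).
move=> /(congr1 (fun M => M^t*)); rewrite adjmxM trmxCK rhoH trmx0 map_mx0 => E.
have -> : (P *m rho *m Q^t*) i j = (row i P *m rho *m Q^t*) 0 j.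
  by rewrite -!row_mul !mxE.
by rewrite d0 E mul0mx !mxE oppr0 mul0r.
Qed.

(** A vanishing coefficient would put a row of the unitary [P] in the left kernel of the invertible
    [sigma]; hence every entry is determined. *)
Lemma sylvester_inj Z1 Z2 : \rank sigma = n ->
  sylvester rho sigma t Z1 -> sylvester rho sigma t Z2 -> Z1 = Z2.
Proof.
move=> sn; have [P [s [PP PtP Ps s0]]] := psdmx_spectral sigma_psd.
have [Q [r [QQ QtQ Qr r0]]] := psdmx_spectral rho_psd.
move=> /(sylvester_spectral _ PP Ps QQ Qr) E1 /(sylvester_spectral _ PP Ps QQ Qr) E2.
suff /(congr1 (fun M => P^t* *m M *m Q)) : P *m Z1 *m Q^t* = P *m Z2 *m Q^t*.
  by rewrite !mulmxA PtP !mul1mx -!mulmxA QtQ !mulmx1.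
apply/matrixP => i j; apply: (@mulfI _ ((1 - t)%:C * r 0 j + t%:C * s 0 i)); last first.
  by rewrite E1 E2.
apply/eqP => /(sylvester_denom_eq0 (r0 j) (s0 i)) /(spectral_row_ker Ps) E.
have sU : sigma \in unitmx by rewrite -row_free_unit /row_free sn.
have Pi0 : row i P = 0 by rewrite -[row i P](mulmxK sU) E mul0mx.
have /matrixP/(_ 0 i) : row i P *m P^t* = row i 1%:M by rewrite -row_mul PP.
by rewrite Pi0 mul0mx !mxE eqxx => /esym/eqP; rewrite oner_eq0.
Qed.

(** The kernel of [sigma] lies in that of [rho], which is trivial. This reduces the uniqueness
    criterion to [sigma] alone. *)
Lemma supp_le_full_rank : \rank rho = n -> \rank sigma = n.
Proof.
move=> rn; apply/eqP; rewrite -/(row_free sigma) -kermx_eq0 -[kermx _]trmxCK.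
have sK : sigma *m (kermx sigma)^t* = 0.
  by rewrite -{1}sigmaH -adjmxM mulmx_ker trmx0 map_mx0.
have rU : rho \in unitmx by rewrite -row_free_unit /row_free rn.
suff -> : (kermx sigma)^t* = 0 by rewrite trmx0 map_mx0.
apply/matrixP => i j.
have : rho *m col j ((kermx sigma)^t*) = 0.
  apply: (supp_le_ker rhoH supp_le).
  by rewrite colE mulmxA sK mul0mx.
move=> /(congr1 (mulmx (invmx rho))); rewrite mulKmx // mulmx0.
by move=> /colP/(_ i); rewrite !mxE.
Qed.

Lemma sylvester_unique_rank Z : sylvester rho sigma t Z ->
  (forall W, sylvester rho sigma t W -> Z = W) -> \rank sigma = n.
Proof.
move=> ZE Zuniq; apply/eqP; rewrite -/(row_free sigma) -kermx_eq0.
apply/negP => /negP; rewrite -nz_row_eq0; set v := nz_row _ => v0.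
have vs : v *m sigma = 0 by apply/sub_kermxP; exact: nz_row_sub.
have sv : sigma *m v^t* = 0 by rewrite -{1}sigmaH -adjmxM vs trmx0 map_mx0.
have vr : v *m rho = 0.
  apply: (@adjmx_inj _ 1 n); rewrite /= adjmxM rhoH (supp_le_ker rhoH supp_le sv).
  by rewrite trmx0 map_mx0.
have /eqP : Z = Z + v^t* *m v.
  apply: Zuniq; rewrite /sylvester mulmxDl mulmxDr -(mulmxA _ v) vr mulmx0 addr0.
  by rewrite (mulmxA sigma) sv mul0mx addr0.
(* Multiplying by [v] on the left gives [|v|^2 v = 0], a contradiction. *)
rewrite addrC -subr_eq subrr eq_sym => /eqP/(congr1 (mulmx v)).
rewrite mulmx0 mulmxA [v *m _]mx11_scalar mul_scalar_mx => /eqP.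
rewrite scaler_eq0 (negPf v0) orbF => /eqP vv.
have := @inner_eq0 _ _ (v^t*); rewrite /inner trmxCK vv => /(_ erefl).
by move=> /(congr1 (fun M => M^t*)); rewrite trmxCK trmx0 map_mx0; apply/eqP.
Qed.

(** * Convexity and optimality *)

Lemma quadratic_ge0 (H : 'M[R[i]]_n) :
  0 <= (1 - t)%:C * \tr (rho *m H^t* *m H) + t%:C * \tr (sigma *m H *m H^t*).
Proof.
case/andP: t_range => t0 t1; apply: addr_ge0; apply: mulr_ge0.
- by rewrite lecR subr_ge0.
(* Cyclicity of the trace brings both terms to the form of [psdmx_tr_ge0], with [H^t*] as the outer
   factor for [rho] and [H] for [sigma]. *)
- rewrite mxtrace_mulC mulmxA -{1}[H]trmxCK; exact: psdmx_tr_ge0.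
- by rewrite lecR ltW.
- rewrite mxtrace_mulC mulmxA; exact: psdmx_tr_ge0.
Qed.

Lemma gC_real Z : gC rho sigma t Z = (g rho sigma t Z)%:C.
Proof.
rewrite /g RRe_real // /gC -addrA; apply: rpredD.
  apply: rpredD; first by rewrite CrealE -mxtrace_adj rhoH.
  apply/CrealP; rewrite -mxtrace_adj adjmxM adjmxD trmxCK rhoH mxtrace_mulC.
  by rewrite addrC.
exact/ger0_real/quadratic_ge0.
Qed.

Lemma gC_add Z H : gC rho sigma t (Z + H) = gC rho sigma t Z
  + (\tr (rho *m H) + ((1 - t)%:C * \tr (rho *m Z^t* *m H)
                       + t%:C * \tr (sigma *m H *m Z^t*)))
  + (\tr (rho *m H^t*) + ((1 - t)%:C * \tr (rho *m H^t* *m Z)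
                          + t%:C * \tr (sigma *m Z *m H^t*)))
  + ((1 - t)%:C * \tr (rho *m H^t* *m H) + t%:C * \tr (sigma *m H *m H^t*)).
Proof.
exact: quadratic_functional_add.
Qed.

(** The slope [l] can stay anonymous: one [l] serves all [a], and it cancels in the convexity
    estimate. *)
Lemma gC_line Z H : exists l : R[i], forall a : R,
  gC rho sigma t (Z + a%:C *: H) = gC rho sigma t Z + a%:C * l + a%:C ^+ 2 *
  ((1 - t)%:C * \tr (rho *m H^t* *m H) + t%:C * \tr (sigma *m H *m H^t*)).
Proof.
exists (\tr (rho *m H) + ((1 - t)%:C * \tr (rho *m Z^t* *m H)
                          + t%:C * \tr (sigma *m H *m Z^t*))
  + (\tr (rho *m H^t*) + ((1 - t)%:C * \tr (rho *m H^t* *m Z)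
                          + t%:C * \tr (sigma *m Z *m H^t*)))) => a.
apply: quadratic_functional_line; exact: conjC_real.
Qed.

Lemma g_convex : operator_convex (g rho sigma t).
Proof.
move=> X Y w /andP[w0 w1].
rewrite -subr_ge0 -lecR rmorphB rmorphD !rmorphM /= -!gC_real.
(* Both endpoints are expanded around the convex combination [V], along the direction [X - Y]. *)
set V := _ *: X + _; have [l gl] := gC_line V (X - Y).
have EX : X = V + w%:C *: (X - Y).
  by rewrite /V rmorphB rmorph1; apply/matrixP => i j; rewrite !mxE; ring.
have EY : Y = V + (w - 1)%:C *: (X - Y).
  by rewrite /V !rmorphB rmorph1; apply/matrixP => i j; rewrite !mxE; ring.
have := gl w; rewrite -EX => gX; have := gl (w - 1); rewrite -EY => gY.
rewrite gX gY.
(* The convexity gap equals [(1 - w) w] times the quadratic part at [X - Y], since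
   [(1 - w) w^2 + w (w - 1)^2 = (1 - w) w]. *)
have : (0 : R[i]) <= ((1 - w) * w)%:C by rewrite lecR mulr_ge0 ?subr_ge0.
move=> /mulr_ge0/(_ (quadratic_ge0 (X - Y))); congr (_ <= _).
by rewrite rmorphM !rmorphB rmorph1; ring.
Qed.

Lemma sylvester_optimizer Z :
  sylvester rho sigma t Z -> is_optimizer (g rho sigma t) Z.
Proof.
move=> ZE; have ZE' := (sylvester_adjE Z).2 ZE.
have gZ W : g rho sigma t Z <= g rho sigma t W.
  rewrite -lecR -!gC_real -(subrKC Z W); move: (W - Z) => H.
  (* Pairing the adjoint equation with [H], and below the equation itself with [H^t*], under the
     trace shows that both first-order groups of [gC_add] vanish. *)
  have E1 : (1 - t)%:C * \tr (rho *m Z^t* *m H) + t%:C * \tr (sigma *m H *m Z^t*)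
      = - \tr (rho *m H).
    have := congr1 (fun A => \tr (A *m H)) ZE'.
    rewrite /= mulNmx linearN mxtrace_comb_mul => <-.
    by rewrite (mxtrace_mulC _ (Z^t*)) [Z^t* *m (_ *m _)]mulmxA.
  have E2 : (1 - t)%:C * \tr (rho *m H^t* *m Z) + t%:C * \tr (sigma *m Z *m H^t*)
      = - \tr (rho *m H^t*).
    have := congr1 (fun A => \tr (A *m H^t*)) ZE.
    rewrite /= mulNmx linearN mxtrace_comb_mul => <-.
    by rewrite (mxtrace_mulC _ Z) [Z *m (_ *m _)]mulmxA.
  by rewrite gC_add E1 E2 !subrr !addr0 lerDl quadratic_ge0.
apply/eqP; rewrite eq_le; apply/andP; split.
  by apply: le_ereal_inf_tmp => _ [W _ <-]; rewrite lee_fin.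
by apply: ereal_inf_lbound; exists Z.
Qed.
End Sylvester.

Theorem lemma4 (R : realType) (n : nat) (rho sigma : 'M[R[i]]_n) (t : R)
    (rho_psd : psdmx rho) (sigma_psd : psdmx sigma)
    (supp_le : supp rho `<=` supp sigma) (t_range : 0 < t <= 1) :
  (forall Z : 'M[R[i]]_n, gC rho sigma t Z = (g rho sigma t Z)%:C) /\
  operator_convex (g rho sigma t) /\
  (forall Z : 'M[R[i]]_n, sylvester_adj rho sigma t Z <-> sylvester rho sigma t Z) /\
  (forall Z : 'M[R[i]]_n,
     sylvester_adj rho sigma t Z -> is_optimizer (g rho sigma t) Z) /\
  (exists Z : 'M[R[i]]_n, sylvester_adj rho sigma t Z) /\
  ((exists! Z : 'M[R[i]]_n, sylvester_adj rho sigma t Z) <->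
     (\rank rho = n \/ \rank sigma = n)).
Proof.
have adjE := sylvester_adjE t rho_psd sigma_psd.
have [Z0 Z0E] := sylvester_solvable rho_psd sigma_psd supp_le t_range.
split; first exact: gC_real.
split; first exact: g_convex.
split; first exact: adjE.
split; first by move=> Z /adjE; exact: sylvester_optimizer.
split; first by exists Z0; apply/adjE.
split=> [[Z [/adjE ZE Zuniq]]|rk].
  right; apply: (sylvester_unique_rank rho_psd sigma_psd supp_le ZE) => W /adjE.
  exact: Zuniq.
have rk_sigma : \rank sigma = n.
  by case: rk => // /(supp_le_full_rank rho_psd sigma_psd supp_le).
exists Z0; split; first exact/adjE.
move=> W /adjE; exact: (sylvester_inj rho_psd sigma_psd t_range rk_sigma Z0E).
Qed.
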